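(* Let $\eta=\frac12$ and $q>1$. Then for all $w\in\mathbb{C}$ satisfying $$w\notin\left\{\frac{-2}{(q-1)q^k},\ \frac{2}{(q-1)q^k}\right\}_{k=0}^{\infty},$$ the equation $D_qx(t)-w\langle x(t)\rangle_{\frac12}=0$, $t\in\mathbb{T}$, does not have Hyers--Ulam stability on $\mathbb{T}$.
   Context: For $q>1$, $\mathbb{N}_0=\{0,1,2,\dots\}$ and $\mathbb{T}=q^{\mathbb{N}_0}=\{1,q,q^2,\dots\}$. For $x:\mathbb{T}\to\mathbb{C}$ and $t\in\mathbb{T}$, define $D_qx(t)=\frac{x(qt)-x(t)}{(q-1)t}$ and, for $\eta\in[0,\frac12]$, $\langle x(t)\rangle_\eta=\eta x(qt)+(1-\eta)x(t)$; thus $\langle x(t)\rangle_{\frac12}=\frac12\left(x(qt)+x(t)\right)$. The equation $D_qx(t)-w\langle x(t)\rangle_\eta=0$ ($t\in\mathbb{T}$) has Hyers--Ulam stability (HUS) iff there exists a constant $K>0$ with the following property: for every $\varepsilon>0$ and every $\phi:\mathbb{T}\to\mathbb{C}$ with $|D_q\phi(t)-w\langle\phi(t)\rangle_\eta|\le\varepsilon$ for all $t\in\mathbb{T}$, there exists a solution $x:\mathbb{T}\to\mathbb{C}$ of the equation such that $|\phi(t)-x(t)|\le K\varepsilon$ for all $t\in\mathbb{T}$. *)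

(* Defs.v *)
From HB Require Import structures.
From mathcomp Require Import all_boot all_order all_algebra.
From mathcomp Require Import boolp classical_sets reals.
From mathcomp Require Import complex.

Set Implicit Arguments.
Unset Strict Implicit.
Unset Printing Implicit Defensive.

Import Order.TTheory GRing.Theory Num.Theory.

Local Open Scope classical_set_scope.
Local Open Scope ring_scope.
Local Open Scope complex_scope.

(* A set coerces to the type of its elements, so [x : qscale q -> R[i]] is a
   function defined on the time scale only. *)
Definition qscale (R : realType) (q : R) : set R := range (fun n : nat => q ^+ n).

Lemma qscale_mulq (R : realType) (q : R) (t : qscale q) :
  q * \val t \in qscale q.
Proof.
have [n _ qn] := set_mem (valP t).
by apply/mem_set; exists n.+1 => //; rewrite exprS qn.
Qed.

Definition qshift (R : realType) (q : R) (t : qscale q) : qscale q :=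
  exist _ (q * \val t) (qscale_mulq t).

Definition Dq (R : realType) (q : R) (x : qscale q -> R[i]) (t : qscale q) : R[i] :=
  (x (qshift t) - x t) / ((q - 1) * \val t)%:C.

Definition qavg (R : realType) (q eta : R) (x : qscale q -> R[i]) (t : qscale q) : R[i] :=
  eta%:C * x (qshift t) + (1 - eta)%:C * x t.

Definition is_solution (R : realType) (q eta : R) (w : R[i])
    (x : qscale q -> R[i]) : Prop :=
  forall t, Dq x t - w * qavg eta x t = 0.

(* The norm of [R[i]] takes its values in [R[i]] (with zero imaginary part),
   whose order compares real parts when imaginary parts agree; the real bounds
   are therefore embedded by [%:C]. *)
Definition Hyers_Ulam_stable (R : realType) (q eta : R) (w : R[i]) : Prop :=
  exists2 K : R, 0 < K &
    forall (eps : R) (phi : qscale q -> R[i]), 0 < eps ->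
      (forall t, `|Dq phi t - w * qavg eta phi t| <= eps%:C) ->
      exists2 x : qscale q -> R[i], is_solution eta w x &
        forall t, `|phi t - x t| <= (K * eps)%:C.

(* Main.v *)
Require Import Defs.
From mathcomp Require Import all_boot all_order all_algebra.
From mathcomp Require Import boolp classical_sets reals.
From mathcomp Require Import complex ring lra.

Import Order.TTheory GRing.Theory Num.Theory.

Local Open Scope ring_scope.
Local Open Scope complex_scope.

Import Normc.

(** On [t = q^n] the equation reads [x (n+1) = r n * x n] with
    [r n = (1 + a n) / (1 - a n)] and [a n = (q - 1) q^n w / 2]. For [w <> 0],
    [a n] grows geometrically, so [- r n] tends to [1] geometrically fast and the
    products [P n] of the [r i] are bounded and bounded away from [0]. Hence a
    perturbation of size one whose phase is tuned so that its contributions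
    add up makes [phi = P * u] with [u] real and growing at least linearly, while
    all solutions [c * P] are bounded. *)

(** * Growth of powers and a bounded recurrence *)

Lemma expr_unbounded {R : archiRealFieldType} (q M : R) :
  1 < q -> exists N, M < q ^+ N.
Proof.
move=> hq.
have bern n : n%:R * (q - 1) <= q ^+ n.
  elim: n => [|n IHn]; first by rewrite mul0r expr0.
  have : 1 <= q ^+ n by rewrite exprn_ege1 // ltW.
  by rewrite exprS -natr1; nra.
exists (Num.bound `|M / (q - 1)|).
apply: lt_le_trans (bern _).
rewrite -ltr_pdivrMr ?subr_gt0 //.
exact: le_lt_trans (ler_norm _) (archi_boundP (normr_ge0 _)).
Qed.

(* [F m := 1 - k / m] with [k := 2 q / (q - 1)] satisfies
   [F m * (m + 1) <= F (q m) * (m - 1)], so [p n / F (s q^n)] is nonincreasing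
   once [s q^n > k]. *)
Lemma mobius_ratio_bounded {R : archiRealFieldType} (q s : R) (p : nat -> R) :
  1 < q -> 0 < s -> (forall n, 0 <= p n) ->
  (forall n, p n.+1 * (s * q ^+ n - 1) <= p n * (s * q ^+ n + 1)) ->
  exists B, forall n, p n <= B.
Proof.
move=> hq s0 p0 hp.
have q1 : 0 < q - 1 by rewrite subr_gt0.
pose k := 2 * q / (q - 1).
have kq : k * (q - 1) = 2 * q by rewrite divfK // gt_eqF.
have k1 : 1 < k by rewrite ltr_pdivlMr //; lra.
(* From [N] on, [m n] is at least [2 * k], which keeps [F n] in [[1/2, 1]]. *)
have [N hN] := @expr_unbounded R q (2 * k / s) hq.
pose m n := s * q ^+ n.
have mS n : m n.+1 = q * m n by rewrite /m exprS mulrCA.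
have mN n : (N <= n)%N -> 2 * k <= m n.
  move=> Nn; rewrite /m [s * _]mulrC -ler_pdivrMr //.
  by apply: le_trans (ltW hN) _; rewrite ler_eXn2l.
pose F n := 1 - k / m n.
have Flo n : (N <= n)%N -> 1 / 2 <= F n.
  move=> /mN h; rewrite /F lerBrDl -lerBrDr ler_pdivrMr; lra.
have Fhi n : (N <= n)%N -> F n <= 1.
  by move=> /mN h; rewrite /F gerBl divr_ge0 //; lra.
have Fstep n : (N <= n)%N -> F n * (m n + 1) <= F n.+1 * (m n - 1).
  move=> /mN h; have mp : 0 < m n by lra.
  rewrite -(ler_pM2l (_ : 0 < q * m n)); last by rewrite mulr_gt0 //; lra.
  have -> : q * m n * (F n * (m n + 1)) = q * (m n - k) * (m n + 1).
    by rewrite /F; field; rewrite gt_eqF.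
  have -> : q * m n * (F n.+1 * (m n - 1)) = (q * m n - k) * (m n - 1).
    by rewrite /F mS; field; rewrite !gt_eqF //; lra.
  (* The choice of [k] cancels the term linear in [m n], leaving the positive excess
     [k * (q + 1)]. *)
  have -> : (q * m n - k) * (m n - 1) =
            q * (m n - k) * (m n + 1) + m n * (k * (q - 1) - 2 * q)
            + k * (q + 1) by ring.
  by rewrite kq subrr mulr0 addr0 lerDl mulr_ge0 //; lra.
have pF n : (N <= n)%N -> p n * F N <= p N * F n.
  elim: n => [|n IHn]; first by rewrite leqn0 => /eqP ->.
  rewrite leq_eqVlt => /predU1P [<- //|]; rewrite ltnS => Nn.
  have h := mN _ Nn; have hf := Flo _ Nn.
  have step : p n.+1 * F n <= p n * F n.+1.
    rewrite -(ler_pM2r (_ : 0 < m n + 1)); last by lra.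
    apply: (@le_trans _ _ (F n.+1 * (p n.+1 * (m n - 1)))).
      by rewrite -mulrA [X in _ <= X]mulrCA ler_wpM2l // Fstep.
    rewrite [p n * _]mulrC -[X in _ <= X]mulrA ler_wpM2l //.
    by apply: le_trans (Flo _ (leqW Nn)); lra.
  have FN := Flo _ (leqnn N); have FS := Flo _ (leqW Nn).
  rewrite -(ler_pM2r (_ : 0 < F n)); last by lra.
  rewrite mulrAC; apply: (@le_trans _ _ (p n * F n.+1 * F N)).
    by rewrite ler_wpM2r //; lra.
  by rewrite mulrAC [X in _ <= X]mulrAC ler_wpM2r ?IHn //; lra.
(* The first term serves [n >= N], by the bounds on [F]; the sum serves the finitely many earlier
   indices. *)
exists (2 * p N + \sum_(i < N) p i) => n.
case: (leqP N n) => Nn.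
  have S0 : 0 <= \sum_(i < N) p i by apply: sumr_ge0.
  have : p n * (1 / 2) <= p N.
    apply: le_trans (le_trans (pF n Nn) _); last by rewrite ler_piMr // Fhi.
    by rewrite ler_wpM2l // Flo.
  by lra.
rewrite (bigD1 (Ordinal Nn)) //=.
have S0 : 0 <= \sum_(i < N | i != Ordinal Nn) p i by apply: sumr_ge0.
by have := p0 N; lra.
Qed.

(** * Complex moduli and the products of Cayley factors *)

Section Cayley.
Context {R : realType}.
Local Open Scope classical_set_scope.
Implicit Types (q : R) (w : R[i]).

Lemma normE (z : R[i]) : `|z| = (normc z)%:C.
Proof. by case: z. Qed.

Lemma normc_ge0 (z : R[i]) : 0 <= normc z.
Proof. by rewrite -lecR -normE normr_ge0. Qed.

Lemma normc_gt0 (z : R[i]) : z != 0 -> 0 < normc z.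
Proof.
by move=> z0; rewrite lt_def normc_ge0 andbT; apply: contra z0 => /eqP/eq0_normc ->.
Qed.

Lemma normcR (x : R) : 0 <= x -> normc x%:C = x.
Proof. by move=> x0; rewrite /normc /= expr0n addr0 sqrtr_sqr ger0_norm. Qed.

(* [le_normcD] and [normcN] are stated on the alias [Rcomplex R], which blocks
   rewriting in [R[i]]. *)
Lemma ler_normc_add (x y : R[i]) : normc (x + y) <= normc x + normc y.
Proof. exact: le_normcD. Qed.

Lemma normc_opp (x : R[i]) : normc (- x) = normc x.
Proof. exact: normcN. Qed.

Lemma normc_add1 (z : R[i]) :
  normc z - 1 <= normc (1 + z) /\ normc (1 + z) <= normc z + 1.
Proof.
split; last by rewrite addrC (le_trans (ler_normc_add _ _)) // normc1.
have := ler_normc_add (1 + z) (- 1).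
by rewrite normc_opp normc1 addrC addKr lerBlDr.
Qed.

(** This is the overview's [a n]: half the graininess [(q - 1) t] at [t = q^n], times [w]. Each
    [r n] is its Cayley transform. *)
Definition cayley_arg q w n : R[i] := ((q - 1) * q ^+ n)%:C * w / 2.

Definition cayley_prod q w n : R[i] :=
  \prod_(i < n) ((1 + cayley_arg q w i) / (1 - cayley_arg q w i)).

Lemma cayley_prodS q w n : 1 - cayley_arg q w n != 0 ->
  (1 - cayley_arg q w n) * cayley_prod q w n.+1 =
  (1 + cayley_arg q w n) * cayley_prod q w n.
Proof.
by move=> h;
  rewrite /cayley_prod big_ord_recr /= mulrCA [LHS]mulrC
  mulrCA divff ?mulr1 // [RHS]mulrC.
Qed.

Lemma normc_cayley_arg q w n : 1 < q ->
  normc (cayley_arg q w n) = (q - 1) * normc w / 2 * q ^+ n.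
Proof.
move=> hq; rewrite /cayley_arg !normcM normcV normcR.
  have -> : (2 : R[i]) = 2%:C by rewrite rmorphMn rmorph1.
  by rewrite normcR //; ring.
by rewrite mulr_ge0 ?exprn_ge0 //; lra.
Qed.

(** With [s q^n = |a n|], the triangle inequality gives [|1 - a n| >= s q^n - 1] and
    [|1 + a n| <= s q^n + 1], so [|P n|] satisfies the recurrence of [mobius_ratio_bounded]. The
    same holds for [1 / |P n|] with the two factors exchanged. *)
Lemma cayley_prod_bounded q w : 1 < q ->
  (forall n, 1 - cayley_arg q w n != 0) ->
  (forall n, 1 + cayley_arg q w n != 0) ->
  exists B, forall n,
    normc (cayley_prod q w n) <= B /\ (normc (cayley_prod q w n))^-1 <= B.
Proof.
move=> hq hm hp.
(* For [w = 0] the scale [s] would vanish, but every factor is then [1]. *)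
have [w0|w0] := eqVneq w 0.
  exists 1 => n; rewrite /cayley_prod big1 ?normc1 ?invr1 //.
  by move=> i _; rewrite /cayley_arg w0 mulr0 mul0r addr0 subr0 divr1.
pose s := (q - 1) * normc w / 2.
have s0 : 0 < s by rewrite /s !mulr_gt0 ?normc_gt0 ?subr_gt0 ?invr_gt0.
pose p n := normc (cayley_prod q w n).
have P0 n : cayley_prod q w n != 0.
  by apply/prodf_neq0 => i _; rewrite mulf_neq0 ?invr_eq0.
have p0 n : 0 < p n by rewrite normc_gt0.
have pS n : normc (1 - cayley_arg q w n) * p n.+1 =
            normc (1 + cayley_arg q w n) * p n.
  by rewrite -!normcM cayley_prodS.
have bnd n := normc_add1 (cayley_arg q w n).
have bndN n := normc_add1 (- cayley_arg q w n).
have [|B1 hB1] := mobius_ratio_bounded q s p hq s0 (fun n => ltW (p0 n)).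
  move=> n; have := p0 n; have := p0 n.+1; have := pS n.
  have [_ up] := bnd n; have [lo _] := bndN n.
  by move: lo up; rewrite normc_opp normc_cayley_arg // -/s; nra.
have pi0 n : 0 <= (p n)^-1 by rewrite invr_ge0 ltW.
have [|B2 hB2] := mobius_ratio_bounded q s (fun n => (p n)^-1) hq s0 pi0.
  move=> n /=; rewrite mulrC ler_pdivrMr //. rewrite -[X in _ <= X]mulrA ler_pdivlMl //.
  have := p0 n; have := p0 n.+1; have := pS n.
  have [lo _] := bnd n; have [_ up] := bndN n.
  by move: lo up; rewrite normc_opp normc_cayley_arg // -/s; nra.
exists (Num.max B1 B2) => n; rewrite !le_max; split; apply/orP; [left|right].
  exact: hB1.
exact: hB2.
Qed.

(** * The time scale indexed by natural numbers *)

Lemma qscale_expr q n : q ^+ n \in qscale q.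
Proof. by apply/mem_set; exists n. Qed.

Definition qpoint q n : qscale q := exist _ (q ^+ n) (qscale_expr q n).

Lemma qshift_qpoint q n : qshift (qpoint q n) = qpoint q n.+1.
Proof. by apply: val_inj; rewrite /= exprS. Qed.

Lemma qpointP q (t : qscale q) : exists n, t = qpoint q n.
Proof.
by have [n _ qn] := set_mem (valP t); exists n; apply: val_inj; rewrite /= qn.
Qed.

(** The exponent picked by [cid] is the right one because the powers of [q > 1] are distinct. *)
Lemma qscale_extension q (z : nat -> R[i]) : 1 < q ->
  exists phi : qscale q -> R[i], forall n, phi (qpoint q n) = z n.
Proof.
move=> hq; pose idx t := cid (qpointP q t).
exists (fun t => z (sval (idx t))) => n; congr z.
have /(congr1 val) /= /esym := svalP (idx (qpoint q n)).
by apply: ieexprIn; lra.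
Qed.

Lemma graininess_neq0 q n : 1 < q -> ((q - 1) * q ^+ n)%:C != 0 :> R[i].
Proof. by move=> hq; rewrite fmorph_eq0 mulf_neq0 ?expf_neq0 //; lra. Qed.

(** Collecting the coefficients of the two values turns the equation into a one-step recurrence.
    Arbitrary [x] is allowed so that it applies to exact and perturbed solutions alike. *)
Lemma residual_qpoint q w (x : qscale q -> R[i]) n : 1 < q ->
  Dq x (qpoint q n) - w * qavg (1 / 2) x (qpoint q n) =
  ((1 - cayley_arg q w n) * x (qpoint q n.+1)
   - (1 + cayley_arg q w n) * x (qpoint q n)) / ((q - 1) * q ^+ n)%:C.
Proof.
move=> hq; rewrite /Dq /qavg qshift_qpoint /= /cayley_arg.
have h0 := graininess_neq0 q n hq.
have -> : (1 - 1 / 2 : R) = 1 / 2 by field.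
have -> : (1 / 2)%:C = 2^-1 :> R[i] by
  rewrite rmorphM rmorph1 mul1r fmorphV rmorphMn rmorph1.
by move: h0; move: (_%:C) => h h0; field.
Qed.

Lemma solution_qpoint q w (x : qscale q -> R[i]) : 1 < q ->
  (forall n, 1 - cayley_arg q w n != 0) -> is_solution (1 / 2) w x ->
  forall n, x (qpoint q n) = x (qpoint q 0) * cayley_prod q w n.
Proof.
move=> hq hm hx; elim=> [|n IHn]; first by rewrite /cayley_prod big_ord0 mulr1.
have := hx (qpoint q n); rewrite residual_qpoint // => /eqP.
rewrite mulf_eq0 invr_eq0 (negPf (graininess_neq0 q n hq)) orbF subr_eq0 => /eqP e.
by apply: (mulfI (hm n)); rewrite e IHn [RHS]mulrCA cayley_prodS // mulrCA.
Qed.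

End Cayley.

(** * An approximate solution far from every solution *)

Theorem theorem3p1 (R : realType) (q : R) (w : R[i]) (hq : 1 < q)
  (hw : forall k : nat,
      w <> (- 2 / ((q - 1) * q ^+ k))%:C /\ w <> (2 / ((q - 1) * q ^+ k))%:C) :
  ~ Hyers_Ulam_stable q (1 / 2) w.
Proof.
have h_gt0 n : 0 < (q - 1) * q ^+ n.
  by rewrite mulr_gt0 ?exprn_gt0 ?subr_gt0 //; lra.
(* The values of [w] excluded by [hw] are exactly those with [a n = 1] or [a n = -1] for some
   [n]. *)
have wE n (c : R) : cayley_arg q w n = c%:C -> w = (c * 2 / ((q - 1) * q ^+ n))%:C.
  move=> e; apply: (mulfI (graininess_neq0 q n hq)).
  rewrite -rmorphM [in RHS]mulrC divfK ?gt_eqF //.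
  by rewrite [RHS]rmorphM /= -e /cayley_arg rmorphMn rmorph1 divfK // pnatr_eq0.
have hm n : 1 - cayley_arg q w n != 0.
  rewrite subr_eq0; apply/eqP => /esym /(wE n 1).
  by rewrite mul1r; case: (hw n).
have hp n : 1 + cayley_arg q w n != 0.
  rewrite addrC addr_eq0 -(rmorph1 (real_complex R)) -rmorphN; apply/eqP => /(wE n (-1)).
  by rewrite mulN1r; case: (hw n).
have P0 n : cayley_prod q w n != 0.
  by apply/prodf_neq0 => i _; rewrite mulf_neq0 ?invr_eq0.
have [B hB] := cayley_prod_bounded q w hq hm hp.
pose p n := normc (cayley_prod q w n).
have p_gt0 n : 0 < p n by rewrite normc_gt0.
have B_gt0 : 0 < B by apply: lt_le_trans (p_gt0 0) (hB 0).1.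
pose den n := (1 - cayley_arg q w n) * cayley_prod q w n.+1.
have den_gt0 n : 0 < normc (den n) by rewrite normc_gt0 // mulf_neq0.
(* For [phi = P * u] the residual at [q^n] is [den n * g n / ((q - 1) q^n)]; this [g] gives it
   modulus exactly [1]. *)
pose g n := (q - 1) * q ^+ n / normc (den n).
pose u n := \sum_(i < n) g i.
pose s := (q - 1) * normc w / 2.
have s_ge0 : 0 <= s by rewrite /s !mulr_ge0 ?normc_ge0 ?subr_ge0 ?invr_ge0 ?ltW.
(* As [q^n >= 1], [|den n|] is at most [(s + 1) q^n B], so the factor [q^n] cancels in the lower
   bound for [g n]. *)
pose delta := (q - 1) / ((s + 1) * B).
have sB_gt0 : 0 < (s + 1) * B by rewrite mulr_gt0 //; lra.
have delta_gt0 : 0 < delta by rewrite divr_gt0 // subr_gt0.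
have delta_le n : delta <= g n.
  rewrite ler_pdivlMr // normcM.
  have [_ up] := normc_add1 (- cayley_arg q w n).
  rewrite normc_opp normc_cayley_arg // -/s in up.
  have q_ge1 : 1 <= q ^+ n by rewrite exprn_ege1 // ltW.
  have -> : (q - 1) * q ^+ n = delta * ((s + 1) * q ^+ n * B).
    by rewrite [X in delta * X]mulrAC mulrA divfK // gt_eqF.
  rewrite ler_wpM2l ?(ltW delta_gt0) // ler_pM ?normc_ge0 ?(hB _).1 //.
  by apply: le_trans up _; rewrite mulrDl mul1r lerD2l.
have u_ge n : delta * n%:R <= u n.
  elim: n => [|n IHn]; first by rewrite /u big_ord0 mulr0.
  by rewrite /u big_ord_recr /= -natr1 mulrDr mulr1 lerD.
have uS n : u n.+1 - u n = g n by apply/eqP; rewrite subr_eq [eqbRHS]addrC /u big_ord_recr.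
case=> K K_gt0 stable.
have [phi phiE] := qscale_extension q (fun n => cayley_prod q w n * (u n)%:C) hq.
have [|x solx hx] := stable 1 phi ltr01.
  move=> t; have [n ->] := qpointP q t; rewrite residual_qpoint // !phiE.
  rewrite [(1 - _) * _ in X in X - _]mulrA [(1 + _) * (_ * _)]mulrA.
  rewrite cayley_prodS // -mulrBr -rmorphB /=.
  rewrite uS -cayley_prodS // -/(den n).
  rewrite normE lecR normcM normcV normcM (normcR (g n)) ?divr_ge0 ?normc_ge0 ?(ltW (h_gt0 n)) //.
  rewrite normcR ?(ltW (h_gt0 n)) // /g [normc _ * _]mulrC.
  by rewrite divfK ?gt_eqF // divff // gt_eqF.
pose c := x (qpoint q 0).
(* At this index [delta * n] exceeds [B * K + |c|], whereas closeness to [x = c * P] would force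
   [u n] below that value. *)
pose n := Num.bound `|(B * K + normc c) / delta|.
have := hx (qpoint q n).
rewrite phiE (solution_qpoint q w) // -/c mulrC -mulrBl normE lecR mulr1 normcM.
rewrite -ler_pdivlMr ?(p_gt0 n) // => dist.
have unc : normc ((u n)%:C - c) <= B * K.
  by apply: le_trans dist _; rewrite mulrC ler_wpM2r ?(hB _).2 // ltW.
have un : u n <= B * K + normc c.
  have un0 : 0 <= u n by apply: le_trans (u_ge n); rewrite mulr_ge0 // ltW.
  rewrite -[u n]normcR // -[(u n)%:C](subrK c).
  by apply: le_trans (ler_normc_add _ _) _; rewrite lerD2r.
have := le_trans (u_ge n) un; apply/negP; rewrite -ltNge [delta * _]mulrC -ltr_pdivrMr //.
exact: le_lt_trans (ler_norm _) (archi_boundP (normr_ge0 _)).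
Qed.
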